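(* There exist entire solutions of $(u_{11}u_{22})^{1/2}=1$ in $\mathbb{R}^2$ that are not quadratic. That is, there exists a coordinate-convex function $u\in C^2(\mathbb{R}^2)$ satisfying $(u_{11}u_{22})^{1/2}=1$ at every point of $\mathbb{R}^2$ such that $u$ is not a polynomial of degree at most $2$.
   Context: Subscripts denote partial derivatives: $u_{ij}=\partial_i\partial_j u$. A continuous function on $\mathbb{R}^2$ is called coordinate-convex if it is convex when restricted to lines parallel to the coordinate axes. For a $C^2$ function this means $u_{11}\ge0$ and $u_{22}\ge0$. An entire solution is a solution defined on all of $\mathbb{R}^2$. *)

(* Defs.v *)
(* Stdlib reals with Coquelicot; functions on R^2 are curried, u : R -> R -> R,
   as in Coquelicot's Derive_2d. *)
From Stdlib Require Export Reals.
From Coquelicot Require Export Coquelicot.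
Open Scope R_scope.

Definition convex_fun (f : R -> R) : Prop :=
  forall a b t : R, 0 <= t <= 1 ->
    f ((1 - t) * a + t * b) <= (1 - t) * f a + t * f b.

Definition coordinate_convex (u : R -> R -> R) : Prop :=
  (forall x y : R, continuity_2d_pt u x y) /\
  (forall y : R, convex_fun (fun x => u x y)) /\
  (forall x : R, convex_fun (fun y => u x y)).

(* [ex_diff_n u 2 x y] says that all partial derivatives of u of order at most 2
   (mixed ones included) exist at (x, y) and are jointly continuous there. *)
Definition C2_on_plane (u : R -> R -> R) : Prop :=
  forall x y : R, ex_diff_n u 2 x y.

Definition polynomial_degree_le2 (u : R -> R -> R) : Prop :=
  exists a b c d e k : R, forall x y : R,
    u x y = a * x ^ 2 + b * (x * y) + c * y ^ 2 + d * x + e * y + k.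

(* Here [partial_derive 2 0 u] is u_11 and [partial_derive 0 2 u] is u_22.
   Coquelicot's derivatives are total; existence comes from [C2_on_plane]. *)
Definition entire_solution (u : R -> R -> R) : Prop :=
  C2_on_plane u /\
  coordinate_convex u /\
  forall x y : R,
    sqrt (partial_derive 2 0 u x y * partial_derive 0 2 u x y) = 1.

(* Main.v *)
Require Import Defs.
From Stdlib Require Import Reals Lra Lia.
From Coquelicot Require Import Coquelicot.
Open Scope R_scope.

(** Separation of variables gives a solution.  If [f] is a positive function
    on the line with [f * f'' = 1], then [u x y = f x * f y] satisfies
    [u_11 * u_22 = (f'' x * f y) * (f x * f'' y) = 1], and both pure second
    derivatives are positive.

    The ODE [f * f'' = 1] with [f 0 = 1], [f' 0 = 0] has the first integral
    [f'^2 / 2 = ln f], that is, [f = exp (p^2 / 2)] where [p = f'].  The equation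
    for the slope is then [p' = exp (- p^2 / 2)], so [p] is the inverse of
    [E s = RInt (fun t => exp (t^2 / 2)) 0 s].  Since [E' >= 1], [E] is a bijection
    of the line with a differentiable inverse ([expanding_inverse]), and [f] is
    therefore defined on the whole line ([exists_self_reciprocal_second_derivative]).

    The solution is not quadratic: on the axis [y = 0] a quadratic [u] would make
    [f] a quadratic polynomial, so [f''] would be constant, hence so would be
    [f = 1 / f''], and then [f'' = 0], which contradicts [f * f'' = 1]. *)

(** * Inverting a function with derivative at least 1 *)

Section ExpandingInverse.

Variables F dF : R -> R.
Hypothesis F_derive : forall x, is_derive F x (dF x).
Hypothesis dF_ge1 : forall x, 1 <= dF x.

Lemma F_continuity : continuity F.
Proof.
intros x; apply derivable_continuous_pt; exists (dF x).
now apply is_derive_Reals.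
Qed.

Lemma expanding_le (a b : R) : a <= b -> b - a <= F b - F a.
Proof.
intros ab.
destruct (MVT_gen F a b dF) as [c [_ ->]].
- intros; apply F_derive.
- intros; apply F_continuity.
- assert (h := dF_ge1 c); nra.
Qed.

Lemma expanding_surjective (y : R) : {x : R | F x = y}.
Proof.
set (b := Rabs (y - F 0)).
assert (b0 : 0 <= b) by apply Rabs_pos.
assert (yb : - b <= y - F 0 <= b)
  by (unfold b, Rabs; destruct Rcase_abs; lra).
assert (Fr := expanding_le 0 b b0).
assert (Fl := expanding_le (- b) 0 ltac:(lra)).
destruct (IVT_gen F (- b) b y F_continuity) as [x [_ Fx]].
- rewrite Rmin_left, Rmax_right; lra.
- now exists x.
Qed.

Lemma expanding_inverse :
  exists g : R -> R, forall x, F (g x) = x /\ is_derive g x (/ dF (g x)).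
Proof.
set (g := fun y => proj1_sig (expanding_surjective y)).
assert (Fg : forall y, F (g y) = y)
  by (intros y; exact (proj2_sig (expanding_surjective y))).
assert (g_incr : forall x y, x <= y -> g x <= g y <= g x + (y - x)).
{ intros x y xy.
  destruct (Rle_or_lt (g x) (g y)) as [h | h].
  - assert (e := expanding_le _ _ h); rewrite !Fg in e; lra.
  - assert (e := expanding_le _ _ (Rlt_le _ _ h)); rewrite !Fg in e; lra. }
exists g; intros x; split; [apply Fg |].
assert (g_cont : continuity_pt g x).
{ intros eps Heps; exists eps; split; [easy | intros z [_ Hz]].
  simpl in *; unfold Rdist in *.
  destruct (Rle_or_lt x z) as [h | h].
  - assert (e := g_incr _ _ h).
    rewrite Rabs_pos_eq in * by lra; lra.
  - assert (e := g_incr _ _ (Rlt_le _ _ h)).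
    rewrite Rabs_left1 in * by lra; lra. }
assert (Prf : forall a, g (x - 1) <= a <= g (x + 1) -> derivable_pt F a).
{ intros a _; exists (dF a); now apply is_derive_Reals. }
assert (Prg : g (x - 1) <= g x <= g (x + 1))
  by (split; apply g_incr; lra).
assert (der : derive_pt F (g x) (Prf (g x) Prg) = dF (g x)).
{ apply derive_pt_eq_0; now apply is_derive_Reals. }
apply is_derive_Reals.
replace (/ dF (g x)) with (1 / derive_pt F (g x) (Prf (g x) Prg))
  by (rewrite der; unfold Rdiv; ring).
apply Ranalysis5.derivable_pt_lim_recip_interv; try lra; auto.
- intros z _; apply Fg.
- rewrite der; assert (h := dF_ge1 (g x)); lra.
Qed.

End ExpandingInverse.

(** * The ordinary differential equation *)

(** The equation [f * f'' = 1] written as a first-order system, with [p = f']. *)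
Lemma exists_self_reciprocal_second_derivative :
  exists f p : R -> R, forall x,
    0 < f x /\ is_derive f x (p x) /\ is_derive p x (/ f x).
Proof.
set (w := fun s => exp (s ^ 2 / 2)).
assert (w_cont : forall s, continuous w s).
{ intros s; apply (ex_derive_continuous w); unfold w; auto_derive; easy. }
destruct (expanding_inverse (RInt w 0) w) as [p p_inv].
- intros s; apply (is_derive_RInt w (RInt w 0) 0 s); [| apply w_cont].
  apply filter_forall; intros z.
  apply (@RInt_correct R_CompleteNormedModule), (@ex_RInt_continuous R_CompleteNormedModule).
  intros; apply w_cont.
- intros s; rewrite <- exp_0; unfold w.
  destruct (Req_dec s 0) as [-> | s0].
  + right; f_equal; lra.
  + left; apply exp_increasing; nra.
- exists (fun x => w (p x)), p; intros x.
  assert (w_pos := exp_pos (p x ^ 2 / 2)).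
  split; [exact w_pos | split; [| apply p_inv]].
  assert (w_derive : is_derive w (p x) (p x * w (p x))).
  { unfold w; auto_derive; [easy | unfold Rdiv; simpl; field]. }
  assert (d := is_derive_comp w p x _ _ w_derive (proj2 (p_inv x))).
  refine (eq_ind _ (is_derive (fun z => w (p z)) x) d _ _).
  change (/ w (p x) * (p x * w (p x)) = p x); unfold w; field; lra.
Qed.

(** * Convexity and smoothness of separated products *)

Lemma convex_fun_derive_increasing (f df : R -> R) :
  (forall x, is_derive f x (df x)) ->
  (forall x y, x <= y -> df x <= df y) ->
  convex_fun f.
Proof.
intros f_derive df_incr.
assert (tangent : forall z a, f z + df z * (a - z) <= f a).
{ intros z a.
  destruct (MVT_gen f z a df) as [c [Hc e]].
  - intros; apply f_derive.
  - intros x _; apply derivable_continuous_pt; exists (df x).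
    now apply is_derive_Reals.
  - destruct (Rle_or_lt z a) as [h | h].
    + rewrite Rmin_left, Rmax_right in Hc by lra.
      assert (d := df_incr z c ltac:(lra)); nra.
    + rewrite Rmin_right, Rmax_left in Hc by lra.
      assert (d := df_incr c z ltac:(lra)); nra. }
intros a b t Ht.
(* Average the tangent line inequalities at the intermediate point. *)
set (z := (1 - t) * a + t * b).
assert (Ha := tangent z a); assert (Hb := tangent z b).
apply (Rmult_le_compat_l (1 - t)) in Ha; [| lra].
apply (Rmult_le_compat_l t) in Hb; [| lra].
assert (e : (1 - t) * (df z * (a - z)) + t * (df z * (b - z)) = 0)
  by (unfold z; ring).
lra.
Qed.

Lemma convex_fun_scal (c : R) (f : R -> R) :
  0 <= c -> convex_fun f -> convex_fun (fun x => c * f x).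
Proof.
intros c0 f_convex a b t Ht.
assert (h := Rmult_le_compat_l c _ _ c0 (f_convex a b t Ht)); lra.
Qed.

Lemma convex_fun_ext (f g : R -> R) :
  (forall x, f x = g x) -> convex_fun f -> convex_fun g.
Proof.
intros fg f_convex a b t Ht; rewrite <- !fg; now apply f_convex.
Qed.

(** Here [f k] and [g k] play the role of the [k]-th derivatives of [f 0] and
    [g 0]. *)
Lemma ex_diff_n_separated (n : nat) :
  forall f g : nat -> R -> R,
  (forall k x, (k < n)%nat -> is_derive (f k) x (f (S k) x)) ->
  (forall k x, (k < n)%nat -> is_derive (g k) x (g (S k) x)) ->
  (forall k x, (k <= n)%nat -> continuity_pt (f k) x) ->
  (forall k x, (k <= n)%nat -> continuity_pt (g k) x) ->
  forall x y, ex_diff_n (fun x y => f 0%nat x * g 0%nat y) n x y.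
Proof.
induction n as [| n IHn]; intros f g f_derive g_derive f_cont g_cont x y.
all: assert (fg_cont : continuity_2d_pt (fun x y => f 0%nat x * g 0%nat y) x y)
  by (apply continuity_2d_pt_mult;
      [ apply (continuity_1d_2d_pt_comp (f 0%nat) (fun u _ => u));
        [apply f_cont; lia | apply continuity_2d_pt_id1]
      | apply (continuity_1d_2d_pt_comp (g 0%nat) (fun _ v => v));
        [apply g_cont; lia | apply continuity_2d_pt_id2] ]).
- now split.
- assert (d1 : forall u v, is_derive (fun z => f 0%nat z * g 0%nat v) u
                             (f 1%nat u * g 0%nat v)).
  { intros u v.
    apply (is_derive_scal_l (f 0%nat) u (f 1%nat u) (g 0%nat v)).
    apply f_derive; lia. }
  assert (d2 : forall u v, is_derive (fun z => f 0%nat u * g 0%nat z) v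
                             (f 0%nat u * g 1%nat v)).
  { intros u v; apply (is_derive_scal (g 0%nat)); apply g_derive; lia. }
  split; [exact fg_cont |].
  split; [eexists; apply d1 |].
  split; [eexists; apply d2 |].
  split.
  + apply ex_diff_n_ext_loc with (fun u v => f 1%nat u * g 0%nat v).
    { apply locally_2d_forall; intros u v; symmetry.
      apply is_derive_unique, d1. }
    apply (IHn (fun k => f (S k)) g); intros k z Hk;
      [apply f_derive | apply g_derive | apply f_cont | apply g_cont]; lia.
  + apply ex_diff_n_ext_loc with (fun u v => f 0%nat u * g 1%nat v).
    { apply locally_2d_forall; intros u v; symmetry.
      apply is_derive_unique, d2. }
    apply (IHn f (fun k => g (S k))); intros k z Hk;
      [apply f_derive | apply g_derive | apply f_cont | apply g_cont]; lia.
Qed.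

(** * The separated solution *)

Section SeparatedSolution.

Variables f p : R -> R.
Hypothesis f_pos : forall x, 0 < f x.
Hypothesis f_derive : forall x, is_derive f x (p x).
Hypothesis p_derive : forall x, is_derive p x (/ f x).

Lemma Derive_2_f_mult (c x : R) :
  Derive_n (fun t => f t * c) 2 x = / f x * c.
Proof.
simpl; rewrite (Derive_ext _ (fun t => p t * c)).
- apply is_derive_unique, (is_derive_scal_l p x (/ f x) c), p_derive.
- intros t; apply is_derive_unique, (is_derive_scal_l f t (p t) c), f_derive.
Qed.

Lemma p_increasing (x y : R) : x <= y -> p x <= p y.
Proof.
intros [xy | ->]; [left | now right].
apply (incr_function p m_infty p_infty (fun z => / f z)); simpl; auto.
intros z _ _; apply Rinv_0_lt_compat, f_pos.
Qed.

Lemma f_convex : convex_fun f.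
Proof. exact (convex_fun_derive_increasing f p f_derive p_increasing). Qed.

Lemma separated_C2 : C2_on_plane (fun x y => f x * f y).
Proof.
intros x y.
set (d := fun k => match k with 0%nat => f | 1%nat => p | _ => fun x => / f x end).
assert (d_derive : forall k z, (k < 2)%nat -> is_derive (d k) z (d (S k) z)).
{ intros [| [| k]] z Hk; [apply f_derive | apply p_derive | lia]. }
assert (cont : forall h l z, is_derive h z l -> continuity_pt h z).
{ intros h l z Hl; apply derivable_continuous_pt; exists l.
  now apply is_derive_Reals. }
assert (d_cont : forall k z, (k <= 2)%nat -> continuity_pt (d k) z).
{ intros [| [| k]] z _; [eapply cont, f_derive | eapply cont, p_derive |].
  apply continuity_pt_inv; [eapply cont, f_derive |].
  assert (h := f_pos z); lra. }
exact (ex_diff_n_separated 2 d d d_derive d_derive d_cont d_cont x y).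
Qed.

Lemma separated_entire_solution : entire_solution (fun x y => f x * f y).
Proof.
split; [exact separated_C2 | split; [split; [| split] |]].
- intros x y; apply (separated_C2 x y).
- intros y; apply convex_fun_ext with (fun x => f y * f x).
  { intros x; ring. }
  apply convex_fun_scal; [apply Rlt_le, f_pos | exact f_convex].
- intros x; apply convex_fun_scal; [apply Rlt_le, f_pos | exact f_convex].
- intros x y; unfold partial_derive.
  change (sqrt (Derive_n (fun t => f t * f y) 2 x
                * Derive_n (fun z => f x * f z) 2 y) = 1).
  rewrite (Derive_n_ext (fun z => f x * f z) (fun z => f z * f x))
    by (intros; ring).
  rewrite !Derive_2_f_mult.
  replace (/ f x * f y * (/ f y * f x)) with 1; [exact sqrt_1 |].
  assert (fx := f_pos x); assert (fy := f_pos y); field; lra.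
Qed.

Lemma separated_not_polynomial :
  ~ polynomial_degree_le2 (fun x y => f x * f y).
Proof.
intros (a & b & c & d & e & k & Hu).
assert (f_second : forall x, / f x * f 0 = 2 * a).
{ intros x; rewrite <- Derive_2_f_mult; simpl.
  rewrite (Derive_ext _ (fun t => 2 * a * t + d)).
  - apply is_derive_unique; auto_derive; [easy | ring].
  - intros t.
    rewrite (Derive_ext _ (fun s => a * s ^ 2 + d * s + k)).
    + apply is_derive_unique; auto_derive; [easy | ring].
    + intros s; rewrite Hu; ring. }
assert (f_const : forall x, f x = f 0).
{ intros x.
  assert (fx := f_pos x); assert (f0 := f_pos 0).
  assert (h := eq_trans (f_second x) (eq_sym (f_second 0))).
  apply Rmult_eq_reg_r, Rinv_eq_reg in h; lra. }
assert (zero : / f 0 * 1 = 0).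
{ rewrite <- Derive_2_f_mult.
  rewrite (Derive_n_ext _ (fun _ => f 0 * 1)).
  - now rewrite Derive_n_const.
  - intros t; now rewrite f_const. }
assert (h := Rinv_0_lt_compat _ (f_pos 0)); lra.
Qed.

End SeparatedSolution.

Theorem theorem1p7 :
  exists u : R -> R -> R, entire_solution u /\ ~ polynomial_degree_le2 u.
Proof.
destruct exists_self_reciprocal_second_derivative as (f & p & H).
exists (fun x y => f x * f y); split.
- apply (separated_entire_solution f p); apply H.
- apply (separated_not_polynomial f p); apply H.
Qed.
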